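(* Suppose Assumption (LICQ), Assumption (G) and Assumption (H) stated in the context hold. Moreover, assume that $\sum_{i=0}^\infty\epsilon_i<M$ for some constant $M>0$, and that problem (SDP) is solvable with optimal value $\phi^*$. Then for any $\epsilon_g,\epsilon_h>0$, the rank-support-adaptive algorithm described in the context returns an $(\epsilon_g,\epsilon_h)$-stationary point of (SDPR) within $O(\epsilon_g^{-2}+\epsilon_h^{-3})$ iterations.
   Context: Notation: $\mathbb{S}^n$ is the space of real symmetric $n\times n$ matrices with $\langle A,B\rangle=\mathrm{Tr}(AB^\top)$; $\|\cdot\|$ is the Frobenius/Euclidean norm (product norm on pairs); $\circ$ is the entrywise product; $[A;B]$ stacks $A$ above $B$; $\mathrm{diag}(M)$ is the vector of diagonal entries of $M$; square roots of vectors are entrywise; $\mathrm{supp}(y)=\{j:y_j\neq0\}$. Integers $n,m,p,k$ with $0\le k\le n$ are fixed. Data: $\phi:\mathbb{S}^n\times\mathbb{R}^p\to\mathbb{R}$ convex and continuously differentiable, $b\in\mathbb{R}^m$, $\mathcal{K}(X,x)=\mathcal{A}(X)+Bx$ with $B\in\mathbb{R}^{m\times p}$, $\mathcal{A}(X)=(\langle A_i,X\rangle)_{i=1}^m$, $A_i\in\mathbb{S}^n$, $\mathcal{A}^*(\lambda)=\sum_i\lambda_iA_i$. (SDP): minimize $\phi(X,x)$ s.t. $\mathcal{K}(X,x)=b$, $X_{1:k,1:k}=I_k$, $X\in\mathbb{S}^n_+$, $x\in\mathbb{R}^p_+$. For $r\ge k$ let $I_{k,r}=[I_k,0_{k\times(r-k)}]$,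 $J=[0_{(n-k)\times k},I_{n-k}]$, and $\widehat R=[I_{k,r};R]\in\mathbb{R}^{n\times r}$ for $R\in\mathbb{R}^{(n-k)\times r}$. (SDPR): minimize $f_r(R,y):=\phi(\widehat R\widehat R^\top,y\circ y)$ over $\Omega_r:=\{(R,y)\in\mathbb{R}^{(n-k)\times r}\times\mathbb{R}^p:\mathcal{G}(R,y)=0\}$, $\mathcal{G}(R,y):=\mathcal{K}(\widehat R\widehat R^\top,y\circ y)-b$. Derivatives: $\mathrm{D}\mathcal{G}(R,y)[(H,h)]=\mathcal{K}(\mathcal{L}_R(H),2y\circ h)$ with $\mathcal{L}_R(H)=\begin{pmatrix}0 & I_{k,r}H^\top \\ H I_{k,r}^\top & RH^\top+HR^\top\end{pmatrix}$, and $\mathrm{D}\mathcal{G}(R,y)^*[\lambda]=2(J\mathcal{A}^*(\lambda)\widehat R,\ (B^\top\lambda)\circ y)$. LICQ holds at $(R,y)$ iff $\mathrm{D}\mathcal{G}(R,y)^*$ is injective. At a point with LICQ, $\lambda$ denotes the unique solution of $\mathrm{D}\mathcal{G}(R,y)\mathrm{D}\mathcal{G}(R,y)^*[\lambda]=\mathrm{D}\mathcal{G}(R,y)[\nabla f_r(R,y)]$; the tangent space is $\mathrm{T}_{(R,y)}\Omega_r=\ker\mathrm{D}\mathcal{G}(R,y)$; the Riemannian gradient is $\mathrm{grad}f_r(R,y)=\nabla f_r(R,y)-\mathrm{D}\mathcal{G}(R,y)^*[\lambda]$. Write $C=\nabla_X\phi(\widehat R\widehat R^\top,y\circ y)$,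 $c=\nabla_x\phi(\widehat R\widehat R^\top,y\circ y)$, $C_{22}=JCJ^\top$, $\tilde{\mathcal{A}}^*(\lambda)=J\mathcal{A}^*(\lambda)J^\top$. A retraction at $(R,y)$ is a map $\mathrm{Rtr}_{(R,y)}:\mathrm{T}_{(R,y)}\Omega_r\to\Omega_r$ with $\mathrm{Rtr}_{(R,y)}(t(H,h))=(R,y)+t(H,h)+o(t)$; one is fixed on each $\Omega_r$. $(\epsilon_g,\epsilon_h)$-stationary point: $(R,y)\in\Omega_r$ (some $r\ge\bar r$) with $\|\mathrm{grad}f_r(R,y)\|\le\epsilon_g$, $C_{22}-\tilde{\mathcal{A}}^*(\lambda)\succeq-\epsilon_hI$ and $c-B^\top\lambda\ge-\epsilon_he$, with $e$ the all-ones vector. Extended set: for $\tau\in\mathbb{N}_+$, $\Omega_r^\tau:=\{(S,Y)\in\mathbb{R}^{(n-k)\times(r+\tau)}\times\mathbb{R}^{p\times2}:\mathcal{K}(\widehat S\widehat S^\top,\mathrm{diag}(YY^\top))=b\}$, with tangent space $\mathrm{T}_{(S,Y)}\Omega_r^\tau=\{(U,V):\mathcal{K}(\mathcal{L}_S(U),2\,\mathrm{diag}(YV^\top))=0\}$ and $f_{r,\tau}(S,Y):=\phi(\widehat S\widehat S^\top,\mathrm{diag}(YY^\top))$. A second-order retraction is fixed on $\Omega_r^\tau$: $\mathrm{Rtr}_{(S,Y)}(t(U,V))=(S,Y)+t(U,V)+\frac{t^2}{2}(W,Z)+o(t^2)\in\Omega_r^\tau$ for some $(W,Z)\in(\mathrm{T}_{(S,Y)}\Omega_r^\tau)^\perp$.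 Given $(R,y)\in\Omega_r$ and $(H,h)\in\mathbb{R}^{(n-k)\times\tau}\times\mathbb{R}^p$ set ( * ) $(S,Y)=([R,0_{(n-k)\times\tau}],[y,0_{p\times1}])$, $(U,V)=([0_{(n-k)\times r},H],[0_{p\times1},h])$. Assumption (LICQ): there is a positive integer $\bar r\ge k$ such that for every $r\ge\bar r$, $\Omega_r\ne\emptyset$ and LICQ holds at every point of $\Omega_r$. Assumption (G): there are $L_g\ge0,\rho_g>0$ such that for all $\bar r\le r\le n$, $(R,y)\in\Omega_r$, and $(H,h)\in\mathrm{T}_{(R,y)}\Omega_r$ with $\sqrt{\|H\|^2+\|h\|^2}\le\rho_g$: $|f_r(\mathrm{Rtr}_{(R,y)}((H,h)))-[f_r(R,y)+\langle(H,h),\mathrm{grad}f_r(R,y)\rangle]|\le\frac{L_g}{2}(\|H\|^2+\|h\|^2)$. Assumption (H) (for the given $\tau$): there are $\rho_h>0,L_h\ge0$ such that for all integers $\bar r\le r\le n$, $(R,y)\in\Omega_r$, and $(H,h)\in\mathbb{R}^{(n-k)\times\tau}\times\mathbb{R}^p$ with $\sqrt{\|H\|^2+\|h\|^2}\le\rho_h$, with $(S,Y),(U,V)$ as in ( * ): $|f_{r,\tau}(\mathrm{Rtr}_{(S,Y)}((U,V)))-(f_r(R,y)+\langle C_{22}-\tilde{\mathcal{A}}^*(\lambda),HH^\top\rangle+\langle c-B^\top\lambda,h\circ h\rangle)|\le\frac{L_h}{6}(\|H\|^2+\|h\|^2)^{3/2}$. Algorithm. Parameters: $r_0\in[\bar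 r,n]$, $\tau\in\mathbb{N}_+$, $\epsilon_g,\epsilon_h>0$, nonnegative numbers $\epsilon_i$ ($i\ge0$), starting point $(R_0,y_0)\in\Omega_{r_0}$. It uses constants $\gamma_g,\gamma_h>0$, independent of $\epsilon_g,\epsilon_h$, for which stepsizes satisfying (a) and (b) below exist for every $\bar r\le r\le n$ and every $(R,y)\in\Omega_r$ (such constants exist under the three assumptions). At iteration $i=0,1,2,\dots$, with $(R_i,y_i)\in\Omega_{r_i}$, and with $\lambda_i$, $C$, $c$ taken at $(R_i,y_i)$: 1. If $\|\mathrm{grad}f_{r_i}(R_i,y_i)\|\ge\epsilon_g$: choose $t_i>0$ such that (a) $f_{r_i}(\mathrm{Rtr}_{(R_i,y_i)}(-t_i\,\mathrm{grad}f_{r_i}(R_i,y_i)))-f_{r_i}(R_i,y_i)\le-\gamma_g\|\mathrm{grad}f_{r_i}(R_i,y_i)\|\min\{1,\|\mathrm{grad}f_{r_i}(R_i,y_i)\|\}$; set $(R_{i+1},y_{i+1})$ equal to the retracted point and $r_i^+=r_i$. 2. Otherwise let $\xi_i$ be the optimal value and $(H_i,h_i)$ a minimizer of $\min\{\langle C_{22}-\tilde{\mathcal{A}}^*(\lambda_i),HH^\top\rangle+\langle c-B^\top\lambda_i,h\circ h\rangle:(H,h)\in\mathbb{R}^{(n-k)\times\tau}\times\mathbb{R}^p,\ \|H\|^2+\|h\|^2=1\}$. If $\max\{-\xi_i,0\}\le\epsilon_h$, return $(R_i,y_i,\lambda_i)$. Else form $(S_i,Y_i),(U_i,V_i)$ by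 ( * ), choose $t_i\ge0$ such that (b) $f_{r_i,\tau}(\mathrm{Rtr}_{(S_i,Y_i)}(t_i(U_i,V_i)))-f_{r_i}(R_i,y_i)\le\gamma_h\xi_i\min\{1,\xi_i^2\}$; let $(S_{i+1},Y_{i+1})=\mathrm{Rtr}_{(S_i,Y_i)}(t_i(U_i,V_i))$, $(R_{i+1},y_{i+1})=(S_{i+1},\sqrt{\mathrm{diag}(Y_{i+1}Y_{i+1}^\top)})$, $r_i^+=r_i+\tau$. 3. If $R_{i+1}$ has more than $n$ columns, replace it by some $R\in\mathbb{R}^{(n-k)\times n}$ with $\widehat R\widehat R^\top=\widehat R_{i+1}\widehat R_{i+1}^\top$ and set $r_i^+=n$. 4. Find $(R',y')\in\Omega_{r'}$ with $\bar r\le r'\le r_i^+$, $\mathrm{supp}(y')\subset\mathrm{supp}(y_{i+1})$ and $f_{r'}(R',y')\le f_{r_i^+}(R_{i+1},y_{i+1})+\epsilon_i$ (no reduction is a permitted choice); set $(R_{i+1},y_{i+1})=(R',y')$, $r_{i+1}=r'$. The $O(\cdot)$ is understood as $\epsilon_g,\epsilon_h\to0$, with an implied constant independent of $\epsilon_g,\epsilon_h$ (the starting point, $M$, $\gamma_g,\gamma_h$ being fixed). *)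

(* Defs.v *)
From HB Require Import structures.
From mathcomp Require Export all_boot all_order all_algebra.
From mathcomp Require Export all_classical all_reals all_analysis.

Set Implicit Arguments.
Unset Strict Implicit.
Unset Printing Implicit Defensive.

Import Order.TTheory GRing.Theory Num.Theory.
Import numFieldNormedType.Exports.
Local Open Scope classical_set_scope.
Local Open Scope ring_scope.

Section Matrices.
Variable R : realType.

Definition frob a b (A B : 'M[R]_(a, b)) : R := \tr (A *m B^T).

(* Euclidean structure on pairs.  The norm `|_| that the library puts on
   matrices and pairs is the max norm; it is used below only inside o(.), where
   the choice of the norm is irrelevant. *)
Definition inner a b c e (P Q : 'M[R]_(a, b) * 'M[R]_(c, e)) : R :=
  frob P.1 Q.1 + frob P.2 Q.2.
Definition pnorm a b c e (P : 'M[R]_(a, b) * 'M[R]_(c, e)) : R :=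
  Num.sqrt (inner P P).

Definition hadamard a b (A B : 'M[R]_(a, b)) : 'M[R]_(a, b) :=
  \matrix_(i, j) (A i j * B i j).

Definition diagv n (A : 'M[R]_n) : 'cV[R]_n := \col_i A i i.

Definition supp p (y : 'cV[R]_p) : {set 'I_p} :=
  [set j | y j 0 != 0]%SET.

Definition psd n (X : 'M[R]_n) : Prop :=
  X^T = X /\ forall v : 'cV[R]_n, 0 <= (v^T *m X *m v) 0 0.

Definition gradient a b p (f : 'M[R]_(a, b) * 'cV[R]_p -> R)
    (P : 'M[R]_(a, b) * 'cV[R]_p) : 'M[R]_(a, b) * 'cV[R]_p :=
  (\matrix_(i, j) 'D_((delta_mx i j, 0) : 'M[R]_(a, b) * 'cV[R]_p) f P,
   \col_i 'D_((0, delta_mx i 0) : 'M[R]_(a, b) * 'cV[R]_p) f P).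

(* Functions on S^n x R^p are functions on all pairs (X, x) of which only the
   values at symmetric X are ever used. *)
Definition symdom n p : set ('M[R]_n * 'cV[R]_p) := [set Z | Z.1^T = Z.1].

(* The gradient with respect to the inner product of S^n x R^p: its (i, j)
   entry is the derivative along (E_ij + E_ji) / 2, the orthogonal projection
   of E_ij on S^n. *)
Definition sym_gradient n p (f : 'M[R]_n * 'cV[R]_p -> R)
    (Z : 'M[R]_n * 'cV[R]_p) : 'M[R]_n * 'cV[R]_p :=
  (\matrix_(i, j) 'D_((2^-1 *: (delta_mx i j + delta_mx j i), 0)
                        : 'M[R]_n * 'cV[R]_p) f Z,
   \col_i 'D_((0, delta_mx i 0) : 'M[R]_n * 'cV[R]_p) f Z).

Definition sym_C1 n p (f : 'M[R]_n * 'cV[R]_p -> R) : Prop :=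
  (forall Z, symdom Z ->
     (fun V : 'M[R]_n * 'cV[R]_p =>
        f (Z + V) - f Z - inner (sym_gradient f Z) V : R^o)
     =o_ (within (@symdom n p) (nbhs (0 : 'M[R]_n * 'cV[R]_p)))
     (fun V : 'M[R]_n * 'cV[R]_p => V))
  /\ {within @symdom n p, continuous (sym_gradient f)}.

Definition sym_convex n p (f : 'M[R]_n * 'cV[R]_p -> R) : Prop :=
  forall Z1 Z2 (t : R), symdom Z1 -> symdom Z2 -> 0 <= t <= 1 ->
    f (t *: Z1 + (1 - t) *: Z2) <= t * f Z1 + (1 - t) * f Z2.

End Matrices.

(* The matrix size n >= k is written k + d, so d stands for n - k. *)
Record sdp_data (R : realType) (m p k d : nat) := SdpData {
  phi : 'M[R]_(k + d) * 'cV[R]_p -> R;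
  Amat : 'I_m -> 'M[R]_(k + d);
  Bmat : 'M[R]_(m, p);
  bvec : 'cV[R]_m
}.

Section Problem.
Variables (R : realType) (m p k d : nat) (D : sdp_data R m p k d).

Definition Aop (X : 'M[R]_(k + d)) : 'cV[R]_m := \col_i frob (Amat D i) X.
Definition Aadj (l : 'cV[R]_m) : 'M[R]_(k + d) := \sum_i l i 0 *: Amat D i.
Definition Kop (X : 'M[R]_(k + d)) (x : 'cV[R]_p) : 'cV[R]_m :=
  Aop X + Bmat D *m x.

Definition sdp_feasible (X : 'M[R]_(k + d)) (x : 'cV[R]_p) : Prop :=
  [/\ Kop X x = bvec D, ulsubmx X = 1%:M, psd X & forall j, 0 <= x j 0].

Definition sdp_solvable_with_value (v : R) : Prop :=
  (exists X x, sdp_feasible X x /\ phi D (X, x) = v) /\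
  (forall X x, sdp_feasible X x -> v <= phi D (X, x)).

Definition fpoint r : Type := 'M[R]_(d, r) * 'cV[R]_p.

(* pid_mx k : 'M_(k, r) is [I_k, 0] when k <= r. *)
Definition hat r (S : 'M[R]_(d, r)) : 'M[R]_(k + d, r) :=
  col_mx (pid_mx k : 'M[R]_(k, r)) S.
Definition Jmx : 'M[R]_(d, k + d) := row_mx 0 1%:M.

Definition lifted r (P : fpoint r) : 'M[R]_(k + d) * 'cV[R]_p :=
  (hat P.1 *m (hat P.1)^T, hadamard P.2 P.2).

Definition fr r (P : fpoint r) : R := phi D (lifted P).
Definition Gmap r (P : fpoint r) : 'cV[R]_m :=
  Kop (lifted P).1 (lifted P).2 - bvec D.
Definition Omega r : set (fpoint r) := [set P | Gmap P = 0].

Definition Lop r (S H : 'M[R]_(d, r)) : 'M[R]_(k + d) :=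
  block_mx 0 ((pid_mx k : 'M[R]_(k, r)) *m H^T)
           (H *m (pid_mx k : 'M[R]_(k, r))^T) (S *m H^T + H *m S^T).

Definition DG r (P V : fpoint r) : 'cV[R]_m :=
  Kop (Lop P.1 V.1) (2 *: hadamard P.2 V.2).
Definition DGadj r (P : fpoint r) (l : 'cV[R]_m) : fpoint r :=
  (2 *: (Jmx *m Aadj l *m hat P.1), 2 *: hadamard ((Bmat D)^T *m l) P.2).

Definition licq_at r (P : fpoint r) : Prop := injective (DGadj P).

Definition tangent r (P : fpoint r) : set (fpoint r) := [set V | DG P V = 0].

(* The multiplier; meaningful at points where LICQ holds, where the equation
   has exactly one solution. *)
Definition lam r (P : fpoint r) : 'cV[R]_m :=
  xget 0 [set l | DG P (DGadj P l) = DG P (gradient (@fr r) P)].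

Definition rgrad r (P : fpoint r) : fpoint r :=
  gradient (@fr r) P - DGadj P (lam P).

(* J (C - A^*(lambda)) J^T and c - B^T lambda, where (C, c) is the gradient of
   phi at (hat R hat R^T, y o y). *)
Definition dualmx r (P : fpoint r) : 'M[R]_d :=
  Jmx *m (sym_gradient (phi D) (lifted P)).1 *m Jmx^T
  - Jmx *m Aadj (lam P) *m Jmx^T.
Definition dualvec r (P : fpoint r) : 'cV[R]_p :=
  (sym_gradient (phi D) (lifted P)).2 - (Bmat D)^T *m lam P.

Definition is_retraction r
    (Rtr : fpoint r -> fpoint r -> fpoint r) : Prop :=
  forall P V, Omega P -> tangent P V ->
    Omega (Rtr P V) /\
    (fun t : R => Rtr P (t *: V) - (P + t *: V))
      =o_ (nbhs (0 : R)) (fun t : R => t : R^o).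

Section Extended.
Variable tau : nat.

Definition epoint r : Type := 'M[R]_(d, r + tau) * 'M[R]_(p, 1 + 1).

Definition elift r (Q : epoint r) : 'M[R]_(k + d) * 'cV[R]_p :=
  (hat Q.1 *m (hat Q.1)^T, diagv (Q.2 *m Q.2^T)).

Definition eOmega r : set (epoint r) :=
  [set Q | Kop (elift Q).1 (elift Q).2 = bvec D].
Definition etangent r (Q : epoint r) : set (epoint r) :=
  [set V | Kop (Lop Q.1 V.1) (2 *: diagv (Q.2 *m V.2^T)) = 0].
Definition frtau r (Q : epoint r) : R := phi D (elift Q).

Definition is_retraction2 r
    (Rtr : epoint r -> epoint r -> epoint r) : Prop :=
  forall Q V, eOmega Q -> etangent Q V ->
    eOmega (Rtr Q V) /\
    exists W : epoint r,
      (forall V', etangent Q V' -> inner W V' = 0) /\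
      (fun t : R => Rtr Q (t *: V) - (Q + t *: V + (t ^+ 2 / 2) *: W))
        =o_ (nbhs (0 : R)) (fun t : R => t ^+ 2 : R^o).

Definition embed r (P : fpoint r) : epoint r := (row_mx P.1 0, row_mx P.2 0).
Definition escape_dir r (V : 'M[R]_(d, tau) * 'cV[R]_p) : epoint r :=
  (row_mx 0 V.1, row_mx 0 V.2).

Definition qform r (P : fpoint r) (V : 'M[R]_(d, tau) * 'cV[R]_p) : R :=
  frob (dualmx P) (V.1 *m V.1^T) + frob (dualvec P) (hadamard V.2 V.2).

(* The optimal value xi of the sphere-constrained subproblem; it is +oo in the
   degenerate case d = p = 0, where the unit sphere is empty. *)
Definition xi r (P : fpoint r) : \bar R :=
  ereal_inf [set (qform P V)%:E | V in [set V | inner V V = 1]].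
Definition is_minimizer r (P : fpoint r)
    (V : 'M[R]_(d, tau) * 'cV[R]_p) : Prop :=
  inner V V = 1 /\ forall V', inner V' V' = 1 -> qform P V <= qform P V'.

End Extended.

Definition assumption_LICQ (rbar : nat) : Prop :=
  forall r, (rbar <= r)%N ->
    (exists P : fpoint r, Omega P) /\ (forall P : fpoint r, Omega P -> licq_at P).

Definition assumption_G (rbar : nat)
    (Rtr : forall r, fpoint r -> fpoint r -> fpoint r) : Prop :=
  exists Lg rhog : R, [/\ 0 <= Lg, 0 < rhog &
    forall r (P V : fpoint r), (rbar <= r <= k + d)%N -> Omega P ->
      tangent P V -> pnorm V <= rhog ->
      `|fr (Rtr r P V) - (fr P + inner V (rgrad P))| <= Lg / 2 * inner V V].

Definition assumption_H (rbar tau : nat)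
    (Rtr2 : forall r, epoint tau r -> epoint tau r -> epoint tau r) : Prop :=
  exists rhoh Lh : R, [/\ 0 < rhoh, 0 <= Lh &
    forall r (P : fpoint r) (V : 'M[R]_(d, tau) * 'cV[R]_p),
      (rbar <= r <= k + d)%N -> Omega P -> pnorm V <= rhoh ->
      `|frtau (Rtr2 r (embed tau P) (escape_dir r V)) - (fr P + qform P V)|
        <= Lh / 6 * (inner V V) `^ (3 / 2)].

Section Algorithm.
Variables (rbar tau : nat)
  (Rtr : forall r, fpoint r -> fpoint r -> fpoint r)
  (Rtr2 : forall r, epoint tau r -> epoint tau r -> epoint tau r)
  (gamma_g gamma_h : R).

Definition grad_stepsize r (P : fpoint r) (t : R) : Prop :=
  0 < t /\
  fr (Rtr P (- t *: rgrad P)) - fr P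
    <= - gamma_g * pnorm (rgrad P) * Num.min 1 (pnorm (rgrad P)).

Definition escape_stepsize r (P : fpoint r) (V : 'M[R]_(d, tau) * 'cV[R]_p)
    (t : R) : Prop :=
  0 <= t /\
  frtau (Rtr2 (embed tau P) (t *: escape_dir r V)) - fr P
    <= gamma_h * fine (xi tau P) * Num.min 1 (fine (xi tau P) ^+ 2).

Definition stepsizes_exist : Prop :=
  forall r (P : fpoint r), (rbar <= r <= k + d)%N -> Omega P ->
    (exists t, grad_stepsize P t) /\
    (forall V, is_minimizer P V -> exists t, escape_stepsize P V t).

(* An iterate: a number of columns r together with a pair (R, y). *)
Definition state : Type := {r : nat & fpoint r}.
Definition st r (P : fpoint r) : state := existT fpoint r P.

Definition stationary (eg eh : R) (s : state) : Prop :=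
  let P := tagged s in
  [/\ (rbar <= tag s)%N, Omega P, pnorm (rgrad P) <= eg,
      psd (dualmx P + eh%:M) & forall j, - eh <= dualvec P j 0].

Variables (eg eh : R) (eps : nat -> R).

Definition returned (s : state) : Prop :=
  pnorm (rgrad (tagged s)) < eg /\
  (maxe (- xi tau (tagged s)) 0 <= eh%:E)%E.

(* The point in s1 comes from s by a retracted gradient step or, if the gradient
   is small, by an escape step into the set with tau more columns, where Y is
   then replaced by the entrywise square root of diag(Y Y^T). *)
Definition update (s s1 : state) : Prop :=
  let P := tagged s in
  (eg <= pnorm (rgrad P) /\
   exists t, grad_stepsize P t /\ s1 = st (Rtr P (- t *: rgrad P)))
  \/
  [/\ pnorm (rgrad P) < eg, ~ returned s &
   exists V t,
     [/\ is_minimizer P V, escape_stepsize P V t &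
      let Q := Rtr2 (embed tau P) (t *: escape_dir (tag s) V) in
      s1 = st (Q.1, map_mx Num.sqrt (diagv (Q.2 *m Q.2^T)))]].

Definition cap_columns (s1 s2 : state) : Prop :=
  ((tag s1 <= k + d)%N /\ s2 = s1)
  \/
  ((k + d < tag s1)%N /\
   exists S : 'M[R]_(d, k + d),
     hat S *m (hat S)^T = hat (tagged s1).1 *m (hat (tagged s1).1)^T /\
     s2 = st (S, (tagged s1).2)).

(* Optional reduction of the number of columns and of the support. *)
Definition reduce (i : nat) (s2 s' : state) : Prop :=
  [/\ Omega (tagged s'), (rbar <= tag s' <= tag s2)%N,
      supp (tagged s').2 \subset supp (tagged s2).2 &
      fr (tagged s') <= fr (tagged s2) + eps i].

(* s' is a possible outcome of the non-returning iteration i started at s. *)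
Definition iteration (i : nat) (s s' : state) : Prop :=
  exists s1 s2, [/\ update s s1, cap_columns s1 s2 & reduce i s2 s'].

(* Total correctness: started at iteration i from s, whatever admissible
   choices are made, the algorithm never gets stuck and returns, after
   performing at most N iterations (the returning one included), a point
   satisfying post. *)
Fixpoint returns_within (post : state -> Prop) (N i : nat) (s : state) : Prop :=
  match N with
  | 0%N => False
  | N'.+1 =>
      (returned s /\ post s)
      \/
      [/\ ~ returned s, exists s', iteration i s s' &
          forall s', iteration i s s' -> returns_within post N' i.+1 s']
  end.

End Algorithm.
End Problem.

(* Main.v *)
From HB Require Import structures.
Require Import Defs.
From mathcomp Require Import ring lra.
Set Implicit Arguments.
Unset Strict Implicit.
Unset Printing Implicit Defensive.
Import Order.TTheory GRing.Theory Num.Theory.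
Import numFieldNormedType.Exports.
Local Open Scope classical_set_scope.
Local Open Scope ring_scope.

(** Every non-returning iteration lowers the objective by a fixed amount, up to
    eps i, while the objective is bounded below by the optimal value of the SDP.

    Stepsizes.  Under LICQ the operator DG o DGadj is bijective, so the
    multiplier solves its equation ([lamP]) and the Riemannian gradient is a
    tangent vector ([rgrad_tangent]).  The quadratic bound of assumption (G) and
    the cubic bound of assumption (H) then give steps whose gain is at least half
    of the gain in the model; the length of the step is limited either by the
    error term or by the radius of validity, whence the minima in the two
    decrease conditions ([grad_stepsizes_exist], [escape_stepsizes_exist]).

    Progress.  If the point is not returned then either its gradient has norm at
    least eg, or the minimal value xi of the quadratic form on the unit sphere is
    below - eh; this minimum is attained by compactness ([minimizer_exists]).
    Either way the objective drops by at least the minimum of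
    gamma_g eg min(1, eg) and gamma_h eh min(1, eh^2) ([update_descent]).
    Collapsing the extended point to a point of Omega and limiting the number of
    columns to n change neither the value nor feasibility, because both depend
    only on the lifted pair; the latter is possible since every d x d Gram matrix
    has a d x d factor ([gram_square_factor], [cap_columns_possible]).

    Counting.  The value gap plus the part of M not yet spent on the errors is a
    nonnegative potential, which bounds the number of iterations by its initial
    value divided by the guaranteed drop ([returns_within_budget]).  For
    tolerances at most 1 this is O(eg^-2 + eh^-3) ([inv_decrement_le]).

    Stationarity.  The bound xi >= - eh extends by homogeneity to all directions.
    Rank one directions H show that the dual matrix is at least - eh I, and the
    coordinate directions h bound the dual vector ([dualmx_psd],
    [dualvec_ge]). *)

(** * The Frobenius inner product *)

Section FrobeniusProduct.
Variable R : realType.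

Lemma trmxZ a b t (A : 'M[R]_(a, b)) : (t *: A)^T = t *: A^T.
Proof. exact: linearZ. Qed.

Lemma trmxD a b (A B : 'M[R]_(a, b)) : (A + B)^T = A^T + B^T.
Proof. exact: linearD. Qed.

Lemma frobE a b (A B : 'M[R]_(a, b)) :
  frob A B = \sum_i \sum_j A i j * B i j.
Proof.
rewrite /frob /mxtrace; apply: eq_bigr => i _; rewrite mxE.
by apply: eq_bigr => j _; rewrite mxE.
Qed.

Lemma frobC a b (A B : 'M[R]_(a, b)) : frob A B = frob B A.
Proof. by rewrite /frob -mxtrace_tr trmx_mul trmxK. Qed.

Lemma frobDr a b (A B C : 'M[R]_(a, b)) : frob A (B + C) = frob A B + frob A C.
Proof. by rewrite /frob linearD mulmxDr mxtraceD. Qed.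

Lemma frobDl a b (A B C : 'M[R]_(a, b)) : frob (A + B) C = frob A C + frob B C.
Proof. by rewrite frobC frobDr !(frobC C). Qed.

Lemma frobZr a b t (A B : 'M[R]_(a, b)) : frob A (t *: B) = t * frob A B.
Proof. by rewrite /frob linearZ -scalemxAr mxtraceZ. Qed.

Lemma frobZl a b t (A B : 'M[R]_(a, b)) : frob (t *: A) B = t * frob A B.
Proof. by rewrite frobC frobZr frobC. Qed.

Lemma frob0r a b (A : 'M[R]_(a, b)) : frob A 0 = 0.
Proof. by rewrite -(scale0r 0) frobZr mul0r. Qed.

Lemma frob_suml a b (I : finType) (F : I -> 'M[R]_(a, b)) C :
  frob (\sum_i F i) C = \sum_i frob (F i) C.
Proof.
by rewrite /frob mulmx_suml linear_sum.
Qed.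

Lemma frob_tr a b (A B : 'M[R]_(a, b)) : frob A^T B^T = frob A B.
Proof. by rewrite /frob -mxtrace_tr trmx_mul !trmxK mxtrace_mulC. Qed.

Lemma frob_mulr a b c (A : 'M[R]_(a, c)) (B : 'M[R]_(a, b)) (C : 'M[R]_(b, c)) :
  frob A (B *m C) = frob (A *m C^T) B.
Proof. by rewrite /frob trmx_mul mulmxA. Qed.

Lemma frob_mull a b c (A : 'M[R]_(a, c)) (B : 'M[R]_(a, b)) (C : 'M[R]_(b, c)) :
  frob A (B *m C) = frob (B^T *m A) C.
Proof. by rewrite /frob trmx_mul mulmxA mxtrace_mulC mulmxA. Qed.

Lemma frob_hadamard a b (A B C : 'M[R]_(a, b)) :
  frob A (hadamard B C) = frob (hadamard A B) C.
Proof.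
rewrite !frobE; apply: eq_bigr => i _; apply: eq_bigr => j _.
by rewrite !mxE mulrA.
Qed.

Lemma frob_ge0 a b (A : 'M[R]_(a, b)) : 0 <= frob A A.
Proof.
rewrite frobE; apply: sumr_ge0 => i _; apply: sumr_ge0 => j _.
by rewrite -expr2 sqr_ge0.
Qed.

Lemma frob_eq0 a b (A : 'M[R]_(a, b)) : frob A A = 0 -> A = 0.
Proof.
rewrite frobE => /eqP; rewrite psumr_eq0; last first.
  by move=> i _; apply: sumr_ge0 => j _; rewrite -expr2 sqr_ge0.
move=> /allP A0; apply/matrixP => i j; rewrite mxE.
have := A0 i (mem_index_enum _); rewrite /= psumr_eq0; last first.
  by move=> l _; rewrite -expr2 sqr_ge0.
by move=> /allP/(_ j (mem_index_enum _)) /=; rewrite mulf_eq0 orbb => /eqP.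
Qed.

Lemma frob_injr a b (A B : 'M[R]_(a, b)) :
  (forall C, frob C A = frob C B) -> A = B.
Proof.
move=> AB; apply/subr0_eq/frob_eq0.
by rewrite -scaleN1r frobDr frobZr AB mulN1r subrr.
Qed.

Lemma innerZ a b c e t (P : 'M[R]_(a, b) * 'M[R]_(c, e)) :
  inner (t *: P) (t *: P) = t ^+ 2 * inner P P.
Proof. by rewrite /inner !frobZl !frobZr; ring. Qed.

Lemma inner_ge0 a b c e (P : 'M[R]_(a, b) * 'M[R]_(c, e)) : 0 <= inner P P.
Proof. by rewrite addr_ge0 ?frob_ge0. Qed.

Lemma inner_eq0 a b c e (P : 'M[R]_(a, b) * 'M[R]_(c, e)) :
  inner P P = 0 -> P = 0.
Proof.
case: P => A B /eqP; rewrite paddr_eq0 ?frob_ge0//=.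
by move=> /andP[/eqP/frob_eq0-> /eqP/frob_eq0->].
Qed.

Lemma pnorm_ge0 a b c e (P : 'M[R]_(a, b) * 'M[R]_(c, e)) : 0 <= pnorm P.
Proof. exact: sqrtr_ge0. Qed.

Lemma sqr_pnorm a b c e (P : 'M[R]_(a, b) * 'M[R]_(c, e)) :
  pnorm P ^+ 2 = inner P P.
Proof. by rewrite sqr_sqrtr ?inner_ge0. Qed.

Lemma pnormZ a b c e t (P : 'M[R]_(a, b) * 'M[R]_(c, e)) :
  pnorm (t *: P) = `|t| * pnorm P.
Proof. by rewrite /pnorm innerZ sqrtrM ?sqr_ge0// sqrtr_sqr. Qed.

End FrobeniusProduct.

(** * Two facts of linear algebra *)

Lemma injective_endo_surjective (R : realType) (m : nat)
    (f : {linear 'cV[R]_m -> 'cV[R]_m}) :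
  injective f -> forall b, exists l, f l = b.
Proof.
move=> fI b; have kf : lker (linfun f) == 0%VS.
  by apply/lker0P => u v; rewrite !lfunE => /fI.
by exists ((linfun f)^-1%VF b); have := lker0_lfunVK kf b; rewrite lfunE.
Qed.

(** Cholesky factorization of a Gram matrix, done on the rows of B: split off
    the component of the lower rows along the first row b.  The remainder B2 is
    orthogonal to b, so the Gram matrix of the lower rows is that of B2 plus the
    rank one term c c^T, and B2 has one row less. *)
Lemma gram_square_factor (R : realType) d q (B : 'M[R]_(d, q)) :
  exists L : 'M[R]_d, L *m L^T = B *m B^T.
Proof.
elim: d B => [|d IH] B; first by exists 0; apply/matrixP => -[].
rewrite -[d.+1]/(1 + d)%N in B *.
set b := usubmx B; set B' := dsubmx B.
set beta := Num.sqrt (frob b b).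
have bb : b *m b^T = (beta ^+ 2)%:M.
  rewrite [LHS]mx11_scalar; congr (_%:M).
  by rewrite sqr_sqrtr ?frob_ge0// /frob /mxtrace big_ord1.
pose c := beta^-1 *: (B' *m b^T).
(* When b = 0 the inverse of beta is 0, so that c = 0 is the right choice. *)
have bc : beta *: c = B' *m b^T.
  have [beta0|betaN0] := eqVneq beta 0; last by rewrite scalerA mulfV ?scale1r.
  suff -> : b = 0 by rewrite trmx0 mulmx0 beta0 scale0r.
  apply: frob_eq0; apply/eqP; rewrite eq_le frob_ge0 andbT.
  by rewrite -sqrtr_eq0 -/beta beta0.
have c0 : beta = 0 -> c = 0 by move=> beta0; rewrite /c beta0 invr0 scale0r.
clearbody c.
pose B2 := B' - beta^-1 *: (c *m b).
have B2b : B2 *m b^T = 0.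
  rewrite mulmxBl -bc -scalemxAl -mulmxA bb mul_mx_scalar.
  rewrite [X in _ - X]scalerA.
  have [beta0|betaN0] := eqVneq beta 0.
    by rewrite beta0 invr0 !(scale0r, mul0r) subrr.
  by rewrite expr2 mulKf // subrr.
have B'E : B' = B2 + beta^-1 *: (c *m b) by rewrite subrK.
have [L L2] := IH B2; clearbody B2.
have bB2 : b *m B2^T = 0 by rewrite -[LHS]trmxK trmx_mul trmxK B2b trmx0.
exists (block_mx beta%:M 0 c L).
rewrite -[B]vsubmxK -/b -/B' tr_col_mx mul_col_row tr_block_mx mulmx_block.
rewrite !trmx0 !mul0mx !mulmx0 !addr0 !tr_scalar_mx -scalar_mxM -expr2 bb.
rewrite mul_scalar_mx mul_mx_scalar bc L2.
congr (block_mx _ _ _ _).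
  by rewrite -linearZ /= bc trmx_mul trmxK.
have cB2 : c *m b *m B2^T = 0 by rewrite -mulmxA bB2 mulmx0.
have B2c : B2 *m (c *m b)^T = 0 by rewrite trmx_mul mulmxA B2b mul0mx.
rewrite B'E trmxD trmxZ mulmxDl !mulmxDr -!scalemxAl -!scalemxAr.
rewrite cB2 B2c !scaler0 addr0 add0r addrC; congr (_ + _).
rewrite trmx_mul -mulmxA (mulmxA b) bb mul_scalar_mx -scalemxAr !scalerA.
have [beta0|betaN0] := eqVneq beta 0.
  by rewrite c0 // trmx0 !(mulmx0, scaler0).
by rewrite expr2 !mulrA mulfVK ?mulVf ?scale1r.
Qed.

(** * The constraint map and the multiplier *)

Section Geometry.
Variables (R : realType) (m p k d : nat) (D : sdp_data R m p k d).

Local Notation pid r := (pid_mx k : 'M[R]_(k, r)).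

Lemma pid_mx_widen q r : (k <= r)%N ->
  pid_mx k = row_mx (pid_mx k) 0 :> 'M[R]_(k, r + q).
Proof.
move=> kr; apply/matrixP => i j; rewrite !mxE.
case: splitP => l jl; rewrite mxE jl //.
case: eqP => // il; have := ltn_ord i.
by rewrite il ltnNge (leq_trans kr) ?leq_addr.
Qed.

Lemma pid_mx_gram r : (k <= r)%N -> pid r *m (pid r)^T = 1%:M.
Proof.
by move=> kr; rewrite tr_pid_mx mul_pid_mx minnn (minn_idPr kr) pid_mx_1.
Qed.

Lemma hat_gram r (S : 'M[R]_(d, r)) : (k <= r)%N ->
  hat k S *m (hat k S)^T =
  block_mx 1%:M (pid r *m S^T) (S *m (pid r)^T) (S *m S^T).
Proof. by move=> kr; rewrite tr_col_mx mul_col_row pid_mx_gram. Qed.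

(** The derivative of S |-> hat S hat S^T in direction H is Z + Z^T with
    Z = (J^T H)(hat S)^T.  This form turns the adjoint of Lop into a computation
    with traces. *)
Lemma LopE r (S H : 'M[R]_(d, r)) :
  let Z := (Jmx R k d)^T *m H *m (hat k S)^T in Lop k S H = Z + Z^T.
Proof.
rewrite /Lop /Jmx /hat /=.
rewrite tr_row_mx trmx0 trmx1 mul_col_mx mul0mx mul1mx tr_col_mx mul_col_row.
rewrite !mul0mx tr_block_mx !trmx0 !trmx_mul !trmxK add_block_mx !addr0 !add0r.
by rewrite addrC.
Qed.

Hypothesis A_sym : forall i, (Amat D i)^T = Amat D i.

Lemma Aadj_sym l : (Aadj D l)^T = Aadj D l.
Proof.
rewrite /Aadj linear_sum; apply: eq_bigr => i _.
by rewrite linearZ /= A_sym.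
Qed.

Lemma frob_Aop l X : frob l (Aop D X) = frob (Aadj D l) X.
Proof.
rewrite /Aadj frob_suml frobE; apply: eq_bigr => i _.
by rewrite big_ord1 mxE frobZl.
Qed.

(** DGadj is the adjoint of DG; the two halves of Lop contribute equally because
    the A_i are symmetric, whence the factor 2. *)
Lemma frob_DG r (P V : fpoint R p d r) l :
  frob l (DG D P V) = inner (DGadj D P l) V.
Proof.
rewrite /DG /Kop /inner frobDr frob_Aop LopE frobDr.
rewrite -[X in _ + frob X _ + _]Aadj_sym frob_tr -mulr2n.
congr (_ + _).
  by rewrite frob_mulr trmxK frob_mull trmxK mulmxA /DGadj /= frobZl ?mulr_natl.
by rewrite frob_mull frobZr frob_hadamard /DGadj /= frobZl ?mulr_natl.
Qed.

Lemma DGadj_linear r (P : fpoint R p d r) :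
  forall a u v, DGadj D P (a *: u + v) = a *: DGadj D P u + DGadj D P v.
Proof.
move=> a u v; rewrite /DGadj; congr pair.
  have -> : Aadj D (a *: u + v) = a *: Aadj D u + Aadj D v.
    rewrite /Aadj scaler_sumr -big_split; apply: eq_bigr => i _ /=.
    by rewrite !mxE scalerDl scalerA.
  rewrite mulmxDr mulmxDl -scalemxAr -scalemxAl scalerDr scalerA.
  by congr (_ + _); rewrite /= scalerA mulrC.
apply/matrixP => i j; rewrite mulmxDr -scalemxAr !mxE; ring.
Qed.

(** An operator that has an adjoint is linear. *)
Lemma DG_linear r (P : fpoint R p d r) :
  forall a u v, DG D P (a *: u + v) = a *: DG D P u + DG D P v.
Proof.
move=> a u v; apply: frob_injr => l.
rewrite [RHS]frobDr [X in _ = X + _]frobZr !frob_DG /inner /= !frobDr !frobZr.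
by ring.
Qed.

Lemma DG0 r (P : fpoint R p d r) : DG D P 0 = 0.
Proof.
by have := DG_linear P (-1) 0 0; rewrite scaleN1r oppr0 addr0 scaleN1r addNr.
Qed.

Lemma tangentZ r (P V : fpoint R p d r) t :
  tangent D P V -> tangent D P (t *: V).
Proof.
rewrite /tangent /= => V0.
by rewrite -[t *: V]addr0 DG_linear V0 DG0 scaler0 addr0.
Qed.

Lemma DGDGadj_linear r (P : fpoint R p d r) :
  linear (fun l => DG D P (DGadj D P l)).
Proof. by move=> a u v; rewrite DGadj_linear DG_linear. Qed.

(** Under LICQ, DG o DGadj is injective, because its quadratic form at l is the
    squared norm of DGadj l; in finite dimension it is then onto. *)
Lemma lamP r (P : fpoint R p d r) : licq_at D P ->
  DG D P (DGadj D P (lam D P)) = DG D P (gradient (@fr _ _ _ _ _ D r) P).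
Proof.
move=> P_licq; pose T l := DG D P (DGadj D P l).
pose T_lin : {linear 'cV[R]_m -> 'cV[R]_m} :=
  HB.pack T (GRing.isLinear.Build _ _ _ _ T (DGDGadj_linear P)).
have T_inj : injective T_lin.
  move=> u v Tuv; apply/subr0_eq/P_licq.
  have DGadj0 : DGadj D P 0 = 0.
    by have := DGadj_linear P (-1) 0 0;
      rewrite scaleN1r oppr0 addr0 scaleN1r addNr.
  rewrite DGadj0; apply: inner_eq0; rewrite -frob_DG.
  have : T_lin (u - v) = 0 by rewrite linearB Tuv subrr.
  by rewrite /= /T => ->; rewrite frob0r.
have [l Tl] :=
  injective_endo_surjective T_inj (DG D P (gradient (@fr _ _ _ _ _ D r) P)).
by rewrite /lam; case: xgetP => [_ -> //|/(_ l)].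
Qed.

(** Needed to feed gradient steps to the retraction and to the Lipschitz bound,
    which are only about tangent vectors. *)
Lemma rgrad_tangent r (P : fpoint R p d r) : licq_at D P ->
  tangent D P (rgrad D P).
Proof.
move=> P_licq; rewrite /tangent /rgrad /=.
by rewrite addrC -scaleN1r DG_linear lamP // scaleN1r addNr.
Qed.

End Geometry.

(** * Feasibility, and the embedding into the extended set *)

Lemma psd_gram (R : realType) a b (M : 'M[R]_(a, b)) : psd (M *m M^T).
Proof.
split=> [|v]; first by rewrite trmx_mul trmxK.
suff -> : (v^T *m (M *m M^T) *m v) 0 0 = frob (v^T *m M) (v^T *m M).
  exact: frob_ge0.
by rewrite /frob /mxtrace big_ord1 trmx_mul trmxK !mulmxA.
Qed.

Section Lifts.
Variables (R : realType) (m p k d : nat) (D : sdp_data R m p k d).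

Lemma lifted_feasible r (P : fpoint R p d r) : (k <= r)%N -> Omega D P ->
  sdp_feasible D (lifted k P).1 (lifted k P).2.
Proof.
move=> kr /subr0_eq PO; split => //; last by move=> j; rewrite mxE -expr2 sqr_ge0.
  by rewrite /lifted /= hat_gram // block_mxKul.
exact: psd_gram.
Qed.

(** The lift of a point of Omega is feasible for the SDP, so the descent of fr is
    bounded below by the optimal value. *)
Lemma fr_ge_opt v r (P : fpoint R p d r) : sdp_solvable_with_value D v ->
  (k <= r)%N -> Omega D P -> v <= fr D P.
Proof.
by move=> [_ vmin] kr PO; rewrite /fr [lifted _ _]surjective_pairing;
  apply: vmin; apply: lifted_feasible.
Qed.

Lemma OmegaE r (P : fpoint R p d r) :
  Omega D P <-> Kop D (lifted k P).1 (lifted k P).2 = bvec D.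
Proof. by split=> [/subr0_eq //|PO]; apply/eqP; rewrite subr_eq0 PO. Qed.

Lemma elift_embed tau r (P : fpoint R p d r) : (k <= r)%N ->
  elift k (embed tau P) = lifted k P.
Proof.
move=> kr; rewrite /elift /lifted /=; congr pair.
  rewrite /hat (pid_mx_widen _ _ kr) -[col_mx _ _]/(block_mx _ _ _ _).
  rewrite block_mxEh tr_row_mx mul_row_col col_mx0 trmx0 mulmx0 addr0.
  by [].
apply/matrixP => i j.
by rewrite tr_row_mx mul_row_col trmx0 mulmx0 addr0 (ord1 j) !mxE big_ord1 !mxE.
Qed.

Lemma embed_eOmega tau r (P : fpoint R p d r) : (k <= r)%N -> Omega D P ->
  eOmega D (embed tau P).
Proof.
move=> kr /OmegaE PO.
suff : Kop D (elift k (embed tau P)).1 (elift k (embed tau P)).2 = bvec D by [].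
by rewrite elift_embed.
Qed.

Lemma Kop0 : Kop D 0 0 = 0.
Proof.
rewrite /Kop mulmx0 addr0; apply/matrixP => i j.
by rewrite !mxE frob0r.
Qed.

(** The columns added by the embedding are zero and the escape direction lives in
    these columns only, so all products between the two vanish. *)
Lemma escape_dir_etangent tau r (P : fpoint R p d r) V : (k <= r)%N ->
  etangent D (embed tau P) (escape_dir r V).
Proof.
move=> kr; rewrite /etangent /embed /escape_dir /=.
set A := Lop _ _ _; set B := 2 *: _.
have -> : A = 0.
  rewrite /A /Lop (pid_mx_widen _ _ kr) !tr_row_mx !mul_row_col !trmx0.
  by rewrite !(mulmx0, mul0mx, addr0) block_mx0.
have -> : B = 0.
  rewrite /B tr_row_mx mul_row_col trmx0 mulmx0 mul0mx addr0.
  by apply/matrixP => i j; rewrite !mxE mulr0.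
exact: Kop0.
Qed.

Lemma escape_dirZ tau r t (V : 'M[R]_(d, tau) * 'cV[R]_p) :
  t *: escape_dir r V = escape_dir r (t *: V).
Proof.
by rewrite /escape_dir; congr pair; rewrite /= scale_row_mx scaler0.
Qed.

Definition collapse tau r (Q : epoint R p d tau r) : fpoint R p d (r + tau) :=
  (Q.1, map_mx Num.sqrt (diagv (Q.2 *m Q.2^T))).

(** diag(Y Y^T) is nonnegative, so taking its entrywise square root loses
    nothing: value and feasibility carry over from the extended set. *)
Lemma lifted_collapse tau r (Q : epoint R p d tau r) :
  lifted k (collapse Q) = elift k Q.
Proof.
congr pair; apply/matrixP => i j; rewrite !mxE -expr2 sqr_sqrtr //.
by apply: sumr_ge0 => l _; rewrite mxE -expr2 sqr_ge0.
Qed.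

(** The first k columns enter the top blocks of hat S hat S^T and must stay; the
    others enter only through their d x d Gram matrix, which has a square
    factor. *)
Lemma cap_columns_possible r (S : 'M[R]_(d, r)) : (k <= r)%N ->
  exists T : 'M[R]_(d, k + d),
    hat k T *m (hat k T)^T = hat k S *m (hat k S)^T.
Proof.
move=> kr; rewrite -(subnKC kr) in S *; move: (r - k)%N S => q S {r kr}.
have [L LL] := gram_square_factor (rsubmx S).
exists (row_mx (lsubmx S) L); rewrite !hat_gram ?leq_addr // -[in RHS](hsubmxK S).
rewrite !pid_mx_row !tr_row_mx !mul_row_col !trmx0 !(mulmx0, mul0mx).
by rewrite LL.
Qed.

End Lifts.

(** * The escape direction subproblem has a minimizer *)

Section EntrywiseContinuity.
Variables (R : realType) (T : topologicalType).

Definition entrywise_continuous a b (F : T -> 'M[R]_(a, b)) :=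
  forall i j, continuous (fun w => F w i j).

Lemma continuous_sumr (I : finType) (F : I -> T -> R) :
  (forall i, continuous (F i)) -> continuous (fun w => \sum_i F i w).
Proof.
by move=> Fc w; apply: cvg_big => [|i _]; [exact: add_continuous|exact: Fc].
Qed.

Lemma continuous_mulr (f g : T -> R) : continuous f -> continuous g ->
  continuous (fun w => f w * g w).
Proof. by move=> fc gc w; apply: cvgM; [exact: fc|exact: gc]. Qed.

Lemma continuous_addr (f g : T -> R) : continuous f -> continuous g ->
  continuous (fun w => f w + g w).
Proof. by move=> fc gc w; apply: cvgD; [exact: fc|exact: gc]. Qed.

Lemma frob_continuous a b (F G : T -> 'M[R]_(a, b)) :
  entrywise_continuous F -> entrywise_continuous G ->
  continuous (fun w => frob (F w) (G w)).
Proof.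
move=> Fc Gc.
rewrite (_ : (fun w => _) = fun w => \sum_i \sum_j F w i j * G w i j).
  apply: continuous_sumr => i; apply: continuous_sumr => j.
  exact: continuous_mulr.
by apply/funext => w; rewrite frobE.
Qed.

Lemma entrywise_continuous_cst a b (A : 'M[R]_(a, b)) :
  entrywise_continuous (fun=> A).
Proof. by move=> i j w; exact: cvg_cst. Qed.

Lemma entrywise_continuous_gram a b (F : T -> 'M[R]_(a, b)) :
  entrywise_continuous F -> entrywise_continuous (fun w => F w *m (F w)^T).
Proof.
move=> Fc i j.
rewrite (_ : (fun w => _) = fun w => \sum_l F w i l * F w j l).
  by apply: continuous_sumr => l; exact: continuous_mulr.
by apply/funext => w; rewrite mxE; apply: eq_bigr => l _; rewrite mxE.
Qed.

Lemma entrywise_continuous_hadamard a b (F : T -> 'M[R]_(a, b)) :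
  entrywise_continuous F ->
  entrywise_continuous (fun w => hadamard (F w) (F w)).
Proof.
move=> Fc i j.
rewrite (_ : (fun w => _) = fun w => F w i j * F w i j).
  exact: continuous_mulr.
by apply/funext => w; rewrite mxE.
Qed.

End EntrywiseContinuity.

Lemma sqr_entry_le_frob (R : realType) a b (A : 'M[R]_(a, b)) i j :
  A i j ^+ 2 <= frob A A.
Proof.
rewrite frobE (bigD1 i) //= (bigD1 j) //= -expr2 -addrA lerDl.
by rewrite addr_ge0 // sumr_ge0 // => l _; rewrite ?sumr_ge0 // => *;
  rewrite -expr2 sqr_ge0.
Qed.

Section SphereMinimum.
Variables (R : realType) (m p k d tau : nat) (D : sdp_data R m p k d).

(** A direction (H, h) is flattened to one row, so that the Heine-Borel theorem
    in R^n applies. *)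
Definition unflatten (w : 'rV[R]_(d * tau + p)) : 'M[R]_(d, tau) * 'cV[R]_p :=
  (vec_mx (lsubmx w), (rsubmx w)^T).

Lemma unflatten_surj V : exists w, unflatten w = V.
Proof.
exists (row_mx (mxvec V.1) V.2^T); rewrite /unflatten row_mxKl row_mxKr.
by rewrite mxvecK trmxK -surjective_pairing.
Qed.

Lemma unflatten1_continuous : entrywise_continuous (fun w => (unflatten w).1).
Proof.
move=> i j; rewrite (_ : (fun w => _) =
    fun w : 'rV[R]_(d * tau + p) => w 0 (lshift p (mxvec_index i j))).
  exact: coord_continuous.
by apply/funext => w; rewrite !mxE.
Qed.

Lemma unflatten2_continuous : entrywise_continuous (fun w => (unflatten w).2).
Proof.
move=> i j; rewrite (_ : (fun w => _) =
    fun w : 'rV[R]_(d * tau + p) => w 0 (rshift (d * tau) i)).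
  exact: coord_continuous.
by apply/funext => w; rewrite !mxE (ord1 j).
Qed.

Lemma unit_sphere_compact :
  compact [set w | inner (unflatten w) (unflatten w) = 1].
Proof.
apply: (@subclosed_compact _ _
    [set w : 'rV[R]_(d * tau + p) | forall i, w ord0 i \in `[-1, 1]]).
- rewrite (_ : mkset _ =
    (fun w => inner (unflatten w) (unflatten w)) @^-1` [set 1]) //.
  have /continuous_closedP : continuous
      (fun w => inner (unflatten w) (unflatten w)).
    apply: continuous_addr; apply: frob_continuous;
      solve [exact: unflatten1_continuous | exact: unflatten2_continuous].
  by apply; exact: closed_eq.
- apply: (@rV_compact _ _ (fun=> `[(-1 : R), 1]%classic)) => _.
  exact: segment_compact.
- move=> w /= w1 i; rewrite in_itv /= -ler_norml.
  rewrite -(@expr_le1 _ 2) // -normrX ger0_norm ?sqr_ge0 // -w1.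
  rewrite /inner; case: (split_ordP i) => j ->.
    case/mxvec_indexP: j => a b.
    have := sqr_entry_le_frob (unflatten w).1 a b.
    by rewrite {1}/unflatten /= !mxE => /le_trans; apply; rewrite lerDl frob_ge0.
  have := sqr_entry_le_frob (unflatten w).2 j 0.
  by rewrite {1}/unflatten /= !mxE => /le_trans; apply; rewrite lerDr frob_ge0.
Qed.

(** The witness V0 excludes the degenerate case d = p = 0, in which the sphere is
    empty. *)
Lemma minimizer_exists r (P : fpoint R p d r) (V0 : 'M[R]_(d, tau) * 'cV[R]_p) :
  inner V0 V0 = 1 -> exists V, is_minimizer (tau := tau) D P V.
Proof.
move=> V01; have [w0 w0E] := unflatten_surj V0.
have qc : continuous (fun w => qform D P (unflatten w)).
  apply: continuous_addr; apply: frob_continuous;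
    try exact: entrywise_continuous_cst.
    exact/entrywise_continuous_gram/unflatten1_continuous.
  exact/entrywise_continuous_hadamard/unflatten2_continuous.
have [] := EVT_min_rV _ unit_sphere_compact (continuous_subspaceT qc).
  by exists w0; rewrite /= w0E.
move=> w; rewrite inE /= => w1 wmin; exists (unflatten w); split => // V V1.
have [v vE] := unflatten_surj V.
by rewrite -vE; apply: wmin; rewrite inE /= vE.
Qed.

Lemma xi_minimizer r (P : fpoint R p d r) (V : 'M[R]_(d, tau) * 'cV[R]_p) :
  is_minimizer D P V -> xi D tau P = (qform D P V)%:E.
Proof.
move=> [V1 Vmin]; apply/eqP; rewrite eq_le; apply/andP; split.
  by apply: ereal_inf_lbound; exists V.
by apply: le_ereal_inf_tmp => _ [W W1 <-]; rewrite lee_fin Vmin.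
Qed.

End SphereMinimum.

(** * A returned point is stationary *)

Section Stationarity.
Variables (R : realType) (m p k d : nat) (D : sdp_data R m p k d).
Hypothesis A_sym : forall i, (Amat D i)^T = Amat D i.

Lemma dualmx_sym r (P : fpoint R p d r) : (dualmx D P)^T = dualmx D P.
Proof.
have grad_sym Z : ((sym_gradient (phi D) Z).1)^T = (sym_gradient (phi D) Z).1.
  by apply/matrixP => i j; rewrite !mxE [delta_mx _ _ + _]addrC.
rewrite /dualmx [LHS]raddfB /= !trmx_mul !trmxK grad_sym.
by rewrite (Aadj_sym A_sym) !mulmxA.
Qed.

Lemma qformZ tau r (P : fpoint R p d r) t (V : 'M[R]_(d, tau) * 'cV[R]_p) :
  qform D P (t *: V) = t ^+ 2 * qform D P V.
Proof.
rewrite [RHS]mulrDr; congr (_ + _); rewrite -frobZr; congr (frob _ _).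
  by rewrite [(t *: V).1]/= trmxZ -scalemxAr -scalemxAl scalerA.
by apply/matrixP => i j; rewrite !mxE; ring.
Qed.

(** Homogeneity of degree 2 extends the bound given by xi from the unit sphere to
    all directions. *)
Lemma qform_ge tau r (P : fpoint R p d r) eh :
  (maxe (- xi D tau P) 0 <= eh%:E)%E ->
  forall V : 'M[R]_(d, tau) * 'cV[R]_p, - eh * inner V V <= qform D P V.
Proof.
move=> xi_le V; have [/inner_eq0 ->|V0] := eqVneq (inner V V) 0.
  by rewrite -(scale0r 0) qformZ innerZ expr0n /= !mul0r mulr0.
have Vgt0 : 0 < inner V V by rewrite lt_def V0 inner_ge0.
pose W := (pnorm V)^-1 *: V.
have W1 : inner W W = 1 by rewrite innerZ exprVn sqr_pnorm mulVf.
have -> : qform D P V = inner V V * qform D P W.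
  by rewrite qformZ exprVn sqr_pnorm mulrA mulfV // mul1r.
rewrite mulrC ler_pM2l // -lee_fin.
apply: (@le_trans _ _ (xi D tau P)).
  by rewrite EFinN leeNl; apply: le_trans xi_le; rewrite le_max lexx.
by apply: ereal_inf_lbound; exists W.
Qed.

(** Test the bound on H with first column v and zeros elsewhere, for which
    H H^T = v v^T; this is where one additional column is needed. *)
Lemma dualmx_psd tau r (P : fpoint R p d r) eh : (0 < tau)%N ->
  (maxe (- xi D tau P) 0 <= eh%:E)%E -> psd (dualmx D P + eh%:M).
Proof.
case: tau => // tau _ /qform_ge q_ge; split.
  by rewrite [LHS]raddfD /= dualmx_sym tr_scalar_mx.
move=> v; have := q_ge (v *m (delta_mx 0 0 : 'M[R]_(1, tau.+1)), 0).
have frob_rank1 X : frob X (v *m v^T) = (v^T *m X *m v) 0 0.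
  rewrite frob_mulr trmxK /frob mxtrace_mulC mulmxA /mxtrace big_ord1.
  by [].
have HH : v *m delta_mx 0 0 *m (v *m (delta_mx 0 0 : 'M[R]_(1, tau.+1)))^T =
    v *m v^T.
  rewrite trmx_mul trmx_delta mulmxA -(mulmxA v) mul_delta_mx.
  by rewrite (_ : delta_mx 0 0 = 1%:M) ?mulmx1 //; apply/matrixP => i j;
    rewrite !mxE !ord1.
rewrite /inner /qform /= HH frob0r addr0.
rewrite (_ : hadamard 0 0 = 0); last first.
  by apply/matrixP => i j; rewrite !mxE mulr0.
rewrite frob0r addr0 [X in _ * X]/frob HH -frob_rank1 frobDl.
rewrite [X in _ -> is_true (_ <= _ + X)]/frob mul_scalar_mx mxtraceZ.
by rewrite trmx_mul trmxK; lra.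
Qed.

(** Test the bound on the coordinate directions of h. *)
Lemma dualvec_ge tau r (P : fpoint R p d r) eh :
  (maxe (- xi D tau P) 0 <= eh%:E)%E -> forall j, - eh <= dualvec D P j 0.
Proof.
move=> /qform_ge q_ge j; have := q_ge (0, delta_mx j 0).
have frob_delta w : frob w (delta_mx j 0 : 'cV[R]_p) = w j 0.
  rewrite frobE (bigD1 j) //= big_ord1 mxE !eqxx mulr1 big1 ?addr0// => i ij.
  by rewrite big_ord1 mxE (negPf ij) mulr0.
rewrite /inner /qform /= mul0mx !frob0r !add0r.
rewrite (_ : hadamard _ _ = delta_mx j 0); last first.
  by apply/matrixP => i l; rewrite !mxE -natrM mulnb andbb.
by rewrite !frob_delta mxE !eqxx mulr1.
Qed.

End Stationarity.

(** * Stepsizes with sufficient decrease *)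

Section Stepsizes.
Variables (R : realType) (m p k d : nat) (D : sdp_data R m p k d).
Variables (rbar tau : nat).
Hypothesis A_sym : forall i, (Amat D i)^T = Amat D i.
Hypothesis k_le_rbar : (k <= rbar)%N.

(** With g the gradient norm, the model decrease t g^2 beats the error
    L t^2 g^2 / 2 by a factor 2 as soon as L t <= 1.  Take t = 1 / (L + 1), or
    t = rho / g if that step leaves the ball of validity; adding 1 to L allows
    L = 0. *)
Lemma grad_stepsizes_exist
    (Rtr : forall r, fpoint R p d r -> fpoint R p d r -> fpoint R p d r) :
  assumption_LICQ D rbar -> assumption_G D rbar Rtr ->
  exists2 gamma_g, 0 < gamma_g &
  forall r (P : fpoint R p d r), (rbar <= r <= k + d)%N -> Omega D P ->
    exists t, grad_stepsize D Rtr gamma_g P t.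
Proof.
move=> LICQ [L [rho [L_ge0 rho_gt0 G]]].
have L1_gt0 : 0 < (L + 1)^-1 by rewrite invr_gt0; lra.
exists (Num.min (L + 1)^-1 rho / 2).
  by rewrite divr_gt0 // lt_min L1_gt0.
move=> r P r_range PO; set gamma := _ / 2.
have g_tan : tangent D P (rgrad D P).
  have /andP[rbar_le _] := r_range.
  by apply: rgrad_tangent => //; apply: (LICQ r rbar_le).2.
set g := pnorm (rgrad D P); have g_ge0 : 0 <= g by exact: pnorm_ge0.
have min_g : Num.min 1 g <= g by rewrite ge_min lexx orbT.
have min_1 : Num.min 1 g <= 1 by rewrite ge_min lexx.
have min_ge0 : 0 <= Num.min 1 g by rewrite le_min ler01.
have gammaL : gamma <= (L + 1)^-1 / 2.
  by rewrite ler_pM2r ?invr_gt0// ge_min lexx.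
have gammarho : gamma <= rho / 2.
  by rewrite ler_pM2r ?invr_gt0// ge_min lexx orbT.
have gamma_ge0 : 0 <= gamma.
  by rewrite divr_ge0 // le_min (ltW L1_gt0) ltW.
have descent t : 0 < t -> t <= (L + 1)^-1 -> t * g <= rho ->
    gamma * Num.min 1 g <= t * g / 2 -> grad_stepsize D Rtr gamma P t.
  move=> t_gt0 tL t_rho t_gamma; split => //.
  have : pnorm (- t *: rgrad D P) <= rho by rewrite pnormZ normrN gtr0_norm.
  move=> /(G r P _ r_range PO (tangentZ A_sym _ g_tan)).
  have -> : inner (- t *: rgrad D P) (rgrad D P) = - t * g ^+ 2.
    by rewrite sqr_pnorm /inner /= !frobZl; ring.
  rewrite innerZ -sqr_pnorm -/g sqrrN ler_norml => /andP[_ Gle].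
  have Lt : L * t <= 1.
    have : (L + 1) * t <= 1 by rewrite -ler_pdivlMl ?mulr1 //; lra.
    by lra.
  have : L / 2 * (t ^+ 2 * g ^+ 2) <= t * g ^+ 2 / 2.
    have : 0 <= (1 - L * t) * (t * g ^+ 2).
      by rewrite mulr_ge0 ?subr_ge0// mulr_ge0 ?sqr_ge0 // ltW.
    by rewrite !expr2; lra.
  have : g * (gamma * Num.min 1 g) <= g * (t * g / 2) by rewrite ler_wpM2l.
  lra.
have [rho_ge|rho_lt] := leP ((L + 1)^-1 * g) rho.
  exists (L + 1)^-1; apply: descent => //.
  have : gamma * Num.min 1 g <= (L + 1)^-1 / 2 * g by rewrite ler_pM.
  by lra.
have g_gt0 : 0 < g.
  rewrite lt_def g_ge0 andbT; apply: contraTneq rho_lt => ->.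
  by rewrite mulr0 -leNgt ltW.
exists (rho / g); apply: descent => //.
- by rewrite divr_gt0.
- by rewrite ler_pdivrMr // ltW.
- by rewrite divfK ?gt_eqF.
- rewrite divfK ?gt_eqF //.
  have : gamma * Num.min 1 g <= rho / 2 * 1 by rewrite ler_pM.
  by lra.
Qed.

(** Let q be the minimal value.  If q >= 0 the step t = 0 is admissible.
    Otherwise the model decrease - t^2 q beats the cubic error L t^3 / 6 by a
    factor 2 as soon as L t <= - 3 q.  Take t = - 3 q / (L + 1), or t = rho if
    that step leaves the ball of validity. *)
Lemma escape_stepsizes_exist
    (Rtr2 : forall r, epoint R p d tau r -> epoint R p d tau r ->
       epoint R p d tau r) :
  assumption_H D rbar Rtr2 ->
  exists2 gamma_h, 0 < gamma_h &
  forall r (P : fpoint R p d r), (rbar <= r <= k + d)%N -> Omega D P ->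
    forall V, is_minimizer D P V ->
      exists t, escape_stepsize D Rtr2 gamma_h P V t.
Proof.
move=> [rho [L [rho_gt0 L_ge0 H]]].
have L1_gt0 : 0 < 3 / (L + 1) by rewrite divr_gt0 //; lra.
pose gamma := Num.min (3 / (L + 1)) rho ^+ 2 / 2.
have gamma_gt0 : 0 < gamma.
  by rewrite divr_gt0 // exprn_gt0 // lt_min L1_gt0.
exists gamma => // r P r_range PO V Vmin.
set q := qform D P V.
have escape t : 0 <= t -> t <= rho ->
    t ^+ 2 * q + L / 6 * t ^+ 3 <= gamma * q * Num.min 1 (q ^+ 2) ->
    escape_stepsize D Rtr2 gamma P V t.
  move=> t_ge0 t_rho t_gamma; split => //; rewrite (xi_minimizer Vmin) /= -/q.
  have : pnorm (t *: V) <= rho.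
    by rewrite pnormZ ger0_norm // /pnorm Vmin.1 sqrtr1 mulr1.
  move=> /(H r P _ r_range PO); rewrite -escape_dirZ qformZ innerZ Vmin.1 mulr1.
  have -> : (t ^+ 2) `^ (3 / 2) = t ^+ 3.
    rewrite -!powR_mulrn // -powRrM; congr (_ `^ _).
    by rewrite mulrC divfK.
  by rewrite ler_norml -/q => /andP[_]; lra.
have [q_ge0|q_lt0] := leP 0 q.
  exists 0; apply: escape => //; first exact: ltW.
  rewrite !expr0n /= mul0r mulr0 addr0.
  apply: mulr_ge0; first exact: mulr_ge0 (ltW gamma_gt0) q_ge0.
  by rewrite le_min ler01 sqr_ge0.
set w := Num.min 1 (q ^+ 2).
have w_ge0 : 0 <= w by rewrite le_min ler01 sqr_ge0.
have w_le1 : w <= 1 by rewrite ge_min lexx.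
have w_leq : w <= q ^+ 2 by rewrite ge_min lexx orbT.
have c_ge0 : 0 <= Num.min (3 / (L + 1)) rho by rewrite le_min !ltW.
have enough t : 0 <= t -> (L + 1) * t <= 3 * - q -> gamma * w <= t ^+ 2 / 2 ->
    t ^+ 2 * q + L / 6 * t ^+ 3 <= gamma * q * w.
  move=> t_ge0 Lt t_gamma.
  have : 0 <= (3 * - q - L * t) * t ^+ 2.
    by rewrite mulr_ge0 ?sqr_ge0 //; lra.
  have : 0 <= (t ^+ 2 / 2 - gamma * w) * - q.
    by rewrite mulr_ge0 //; lra.
  by rewrite !exprS expr0; lra.
have [rho_ge|rho_lt] := leP (3 / (L + 1) * - q) rho.
  exists (3 / (L + 1) * - q); apply: escape => //.
    by rewrite mulr_ge0 //; lra.
  apply: enough; first by rewrite mulr_ge0 //; lra.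
    by rewrite mulrA mulrCA mulfV ?mulr1 //; apply: lt0r_neq0; lra.
  rewrite exprMn sqrrN [leRHS]mulrAC ler_pM ?(ltW gamma_gt0) //.
  rewrite /gamma ler_pM2r ?invr_gt0 //
    ler_pXn2r ?nnegrE ?(ltW L1_gt0) ?(ltW rho_gt0) //.
  by rewrite ge_min lexx.
exists rho; apply: escape => //; first exact: ltW.
apply: enough; first exact: ltW.
  rewrite -ler_pdivlMl; last lra.
  by apply: ltW; apply: lt_le_trans rho_lt _; rewrite mulrA [_^-1 * _]mulrC.
rewrite -[leRHS]mulr1 ler_pM ?(ltW gamma_gt0) //.
rewrite /gamma ler_pM2r ?invr_gt0 //
  ler_pXn2r ?nnegrE ?(ltW L1_gt0) ?(ltW rho_gt0) //.
by rewrite ge_min lexx orbT.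
Qed.

End Stepsizes.

(** * Descent along the iterations *)

Section Iterations.
Variables (R : realType) (m p k d : nat) (D : sdp_data R m p k d).
Variables (rbar tau : nat).
Variables (Rtr : forall r, fpoint R p d r -> fpoint R p d r -> fpoint R p d r)
  (Rtr2 : forall r, epoint R p d tau r -> epoint R p d tau r ->
     epoint R p d tau r).
Arguments Rtr : clear implicits.
Arguments Rtr2 : clear implicits.
Variables (gamma_g gamma_h : R).
Hypotheses (A_sym : forall i, (Amat D i)^T = Amat D i) (k_le_rbar : (k <= rbar)%N)
  (tau_gt0 : (0 < tau)%N)
  (Rtr_retr : forall r, (rbar <= r)%N -> is_retraction D (Rtr r))
  (Rtr2_retr : forall r, (rbar <= r)%N -> is_retraction2 D (Rtr2 r))
  (LICQ : assumption_LICQ D rbar)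
  (gamma_g_gt0 : 0 < gamma_g) (gamma_h_gt0 : 0 < gamma_h)
  (steps : stepsizes_exist D rbar Rtr Rtr2 gamma_g gamma_h).
Variables (eg eh : R) (eps : nat -> R).
Hypotheses (eg_gt0 : 0 < eg) (eh_gt0 : 0 < eh) (eps_ge0 : forall i, 0 <= eps i).

Definition valid (s : state R p d) : Prop :=
  (rbar <= tag s <= k + d)%N /\ Omega D (tagged s).

(** What a non-returning iteration gains at least, before the loss eps i allowed
    in the reduction. *)
Definition decrement : R :=
  Num.min (gamma_g * eg * Num.min 1 eg) (gamma_h * eh * Num.min 1 (eh ^+ 2)).

Lemma decrement_gt0 : 0 < decrement.
Proof.
by rewrite lt_min !mulr_gt0 // lt_min ltr01 ?exprn_gt0.
Qed.

Lemma returned_stationary s : valid s -> returned D tau eg eh s ->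
  stationary D rbar eg eh s.
Proof.
move=> [/andP[rbar_le _] sO] [g_lt xi_le]; split => //.
- exact: ltW.
- exact: (dualmx_psd A_sym tau_gt0).
- exact: dualvec_ge xi_le.
Qed.

Lemma not_returned_xi (s : state R p d) (V : 'M[R]_(d, tau) * 'cV[R]_p) :
  pnorm (rgrad D (tagged s)) < eg -> ~ returned D tau eg eh s ->
  is_minimizer D (tagged s) V ->
  fine (xi D tau (tagged s)) < - eh.
Proof.
move=> g_lt not_ret Vmin; rewrite ltNge; apply/negP => xi_ge; apply: not_ret.
split => //; move: xi_ge; rewrite (xi_minimizer Vmin) /= => q_ge.
by rewrite ge_max !lee_fin (ltW eh_gt0) andbT; lra.
Qed.

Lemma update_feasible s s1 : valid s ->
  update D Rtr Rtr2 gamma_g gamma_h eg eh s s1 ->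
  (rbar <= tag s1)%N /\ Omega D (tagged s1).
Proof.
case: s => r P [/andP[/= rbar_le r_le] PO].
case=> [[_ [t [_ ->]]]|[_ _ [V [t [_ _ ->]]]]].
  split => //; apply: (Rtr_retr rbar_le PO _).1.
  apply: (tangentZ A_sym); apply: (rgrad_tangent A_sym).
  exact: (LICQ rbar_le).2.
have kr := leq_trans k_le_rbar rbar_le.
split; first by rewrite /= (leq_trans rbar_le) ?leq_addr.
apply/OmegaE; rewrite [lifted _ _]lifted_collapse.
apply: (Rtr2_retr rbar_le (embed_eOmega tau kr PO) _).1.
by rewrite escape_dirZ; apply: escape_dir_etangent.
Qed.

Lemma update_descent s s1 : valid s ->
  update D Rtr Rtr2 gamma_g gamma_h eg eh s s1 ->
  fr D (tagged s1) <= fr D (tagged s) - decrement.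
Proof.
case: s => r P [/andP[/= rbar_le r_le] PO].
case=> [[/= g_ge [t [[_ dec] ->]]]|[/= g_lt not_ret [V [t [Vmin [_ dec] ->]]]]] /=.
  suff : decrement <=
      gamma_g * pnorm (rgrad D P) * Num.min 1 (pnorm (rgrad D P)).
    by move: dec; rewrite !mulNr; lra.
  rewrite ge_min; apply/orP; left.
  rewrite ler_pM ?ler_pM2l ?mulr_ge0 ?(ltW gamma_g_gt0) ?(ltW eg_gt0) //.
    by rewrite le_min ler01 ltW.
  by rewrite le_min ge_min lexx /= ge_min g_ge orbT.
have := not_returned_xi (s := st P) g_lt not_ret Vmin; rewrite /=.
set x := fine _ => x_lt; rewrite -/x in dec.
rewrite [fr _ _]/fr [lifted _ _]lifted_collapse -/(frtau _ _).
suff : decrement <= gamma_h * - x * Num.min 1 (x ^+ 2).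
  by move: dec; rewrite mulrN mulNr; lra.
have x_ge : eh <= - x by lra.
rewrite ge_min; apply/orP; right.
rewrite ler_pM ?ler_pM2l ?mulr_ge0 ?(ltW gamma_h_gt0) ?(ltW eh_gt0) //.
  by rewrite le_min ler01 sqr_ge0.
rewrite le_min ge_min lexx /= ge_min -[x ^+ 2]sqrrN.
by rewrite lerXn2r ?orbT ?nnegrE ?(ltW eh_gt0) ?(le_trans (ltW eh_gt0) x_ge).
Qed.

Lemma cap_columns_spec s1 s2 : (rbar <= tag s1)%N -> Omega D (tagged s1) ->
  cap_columns k s1 s2 ->
  [/\ (tag s2 <= k + d)%N, Omega D (tagged s2) &
      fr D (tagged s2) = fr D (tagged s1)].
Proof.
move=> rbar_le s1O [[s1_le ->] //|[_ [S [SS ->]]]] /=.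
have lifted_eq : lifted k (S, (tagged s1).2) = lifted k (tagged s1).
  by rewrite /lifted SS.
split => //; last by rewrite /fr lifted_eq.
by apply/OmegaE; rewrite lifted_eq; apply/OmegaE.
Qed.

Lemma cap_columns_exists s1 : (rbar <= tag s1)%N -> (rbar <= k + d)%N ->
  exists2 s2 : state R p d, cap_columns k s1 s2 & (rbar <= tag s2)%N.
Proof.
move=> rbar_le rbar_n; have [s1_le|s1_gt] := leqP (tag s1) (k + d)%N.
  by exists s1; first left.
have [T TT] := cap_columns_possible (tagged s1).1 (leq_trans k_le_rbar rbar_le).
exists (st (T, (tagged s1).2)) => //.
by right; split => //; exists T.
Qed.

Lemma iteration_descent i s s' : valid s ->
  iteration D rbar Rtr Rtr2 gamma_g gamma_h eg eh eps i s s' ->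
  valid s' /\ fr D (tagged s') <= fr D (tagged s) - decrement + eps i.
Proof.
move=> s_valid [s1 [s2 [up cap [s'O /andP[rbar_le s'_le] _ red]]]].
have [s1_ge s1O] := update_feasible s_valid up.
have [s2_le s2O s2E] := cap_columns_spec s1_ge s1O cap.
split; first by split; rewrite ?rbar_le ?(leq_trans s'_le).
apply: le_trans red _; rewrite s2E lerD2r; exact: update_descent.
Qed.

(** If the unit sphere is empty then xi = +oo, and a point with a small gradient
    is returned; otherwise a minimizer exists. *)
Lemma update_exists s : valid s -> ~ returned D tau eg eh s ->
  exists s1, update D Rtr Rtr2 gamma_g gamma_h eg eh s s1.
Proof.
case: s => r P [/= r_range PO] not_ret.
have [grad_step escape_step] := steps r_range PO.
have [g_ge|g_lt] := leP eg (pnorm (rgrad D P)).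
  have [t tP] := grad_step; exists (st (Rtr r P (- t *: rgrad D P))).
  by left; split => //; exists t.
have [[V0 V01]|noV] :=
  pselect (exists V : 'M[R]_(d, tau) * 'cV[R]_p, inner V V = 1).
  have [V Vmin] := minimizer_exists D P V01; have [t tP] := escape_step V Vmin.
  by eexists; right; split => //; exists V, t.
case: not_ret; split => //=; rewrite /xi.
rewrite (_ : [set _ | _ in _] = set0) ?ereal_inf0; last first.
  by apply/seteqP; split => // x [V V1 _]; apply: noV; exists V.
by rewrite /= ge_max leNye lee_fin ltW.
Qed.

Lemma iteration_exists i s : valid s -> ~ returned D tau eg eh s ->
  exists s', iteration D rbar Rtr Rtr2 gamma_g gamma_h eg eh eps i s s'.
Proof.
move=> s_valid /(update_exists s_valid)[s1 up].
have [s1_ge s1O] := update_feasible s_valid up.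
have [/andP[s_ge s_le] _] := s_valid.
have [s2 cap s2_ge] := cap_columns_exists s1_ge (leq_trans s_ge s_le).
have [s2_le s2O _] := cap_columns_spec s1_ge s1O cap.
exists s2, s1, s2; split => //; split => //; first by rewrite s2_ge /=.
by rewrite lerDl.
Qed.

(** The potential (value gap) + (part of M not yet spent on the eps j) is
    nonnegative and each non-returning iteration lowers it by at least the
    decrement, the loss eps i being paid from M. *)
Lemma returns_within_budget phistar M :
  sdp_solvable_with_value D phistar ->
  (forall i, \sum_(j < i) eps j <= M) ->
  forall N i s, valid s ->
    fr D (tagged s) - phistar + (M - \sum_(j < i) eps j) < N%:R * decrement ->
    returns_within D rbar Rtr Rtr2 gamma_g gamma_h eg eh eps
      (stationary D rbar eg eh) N i s.
Proof.
move=> solv eps_le; elim=> [|N IH] i s s_valid budget /=.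
  have [/andP[s_ge _] sO] := s_valid.
  have := fr_ge_opt solv (leq_trans k_le_rbar s_ge) sO.
  by have := eps_le i; move: budget; rewrite mul0r; lra.
have [ret|not_ret] := pselect (returned D tau eg eh s).
  by left; split => //; apply: returned_stationary.
right; split => //; first exact: iteration_exists.
move=> s' it; have [s'_valid dec] := iteration_descent s_valid it.
apply: IH => //; rewrite big_ord_recr /=.
by move: budget; rewrite -natr1 mulrDl mul1r; lra.
Qed.

End Iterations.

(** * The iteration bound *)

Lemma partial_sum_le (R : realType) (eps : nat -> R) (M : R) :
  (forall i, 0 <= eps i) -> (\sum_(0 <= i <oo) (eps i)%:E < M%:E)%E ->
  forall i, \sum_(j < i) eps j <= M.
Proof.
move=> eps_ge0 sum_lt i; rewrite -lee_fin; apply: le_trans (ltW sum_lt).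
rewrite -sumEFin -(big_mkord xpredT (fun j => (eps j)%:E)).
by apply: nneseries_lim_ge => j _ _; rewrite lee_fin.
Qed.

(** For tolerances at most 1 the decrement is the minimum of gamma_g eg^2 and
    gamma_h eh^3, and the inverse of a minimum is at most the sum of the
    inverses. *)
Lemma inv_decrement_le (R : realType) (gamma_g gamma_h eg eh : R) :
  0 < gamma_g -> 0 < gamma_h -> 0 < eg <= 1 -> 0 < eh <= 1 ->
  (decrement gamma_g gamma_h eg eh)^-1 <=
    gamma_g^-1 * eg ^- 2 + gamma_h^-1 * eh ^- 3.
Proof.
move=> gg_gt0 gh_gt0 /andP[eg_gt0 eg_le1] /andP[eh_gt0 eh_le1].
rewrite /decrement (min_idPr eg_le1).
rewrite (min_idPr (exprn_ile1 _ (ltW eh_gt0) eh_le1)).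
rewrite -!mulrA -expr2 -exprS -!invfM.
rewrite /Num.min; case: ifP => _; [rewrite lerDl|rewrite lerDr];
  by rewrite invr_ge0 mulr_ge0 ?exprn_ge0 // ltW.
Qed.

Theorem theorem1 (R : realType) (m p k d : nat) (D : sdp_data R m p k d)
  (phi_convex : sym_convex (phi D)) (phi_C1 : sym_C1 (phi D))
  (A_sym : forall i, (Amat D i)^T = Amat D i)
  (rbar : nat) (rbar_gt0 : (0 < rbar)%N) (rbar_ge : (k <= rbar)%N)
  (tau : nat) (tau_gt0 : (0 < tau)%N)
  (Rtr : forall r, fpoint R p d r -> fpoint R p d r -> fpoint R p d r)
  (Rtr_retr : forall r, (rbar <= r)%N -> is_retraction D (Rtr r))
  (Rtr2 : forall r, epoint R p d tau r -> epoint R p d tau r ->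
     epoint R p d tau r)
  (Rtr2_retr : forall r, (rbar <= r)%N -> is_retraction2 D (Rtr2 r))
  (H_LICQ : assumption_LICQ D rbar)
  (H_G : assumption_G D rbar Rtr)
  (H_H : assumption_H D rbar Rtr2)
  (phistar : R) (H_solvable : sdp_solvable_with_value D phistar)
  (M : R) (M_gt0 : 0 < M)
  (r0 : nat) (r0_range : (rbar <= r0 <= k + d)%N)
  (P0 : fpoint R p d r0) (P0_feas : Omega D P0) :
  (exists gamma_g gamma_h : R, [/\ 0 < gamma_g, 0 < gamma_h &
     stepsizes_exist D rbar Rtr Rtr2 gamma_g gamma_h]) /\
  (forall gamma_g gamma_h : R, 0 < gamma_g -> 0 < gamma_h ->
     stepsizes_exist D rbar Rtr Rtr2 gamma_g gamma_h ->
     exists K delta : R, [/\ 0 < K, 0 < delta &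
       forall eps : nat -> R, (forall i, 0 <= eps i) ->
         (\sum_(0 <= i <oo) (eps i)%:E < M%:E)%E ->
       forall eg eh : R, 0 < eg -> 0 < eh ->
         exists N : nat,
           returns_within D rbar Rtr Rtr2 gamma_g gamma_h eg eh eps
             (stationary D rbar eg eh) N 0%N (st P0) /\
           (eg <= delta -> eh <= delta ->
              N%:R <= K * (eg ^- 2 + eh ^- 3))]).
Proof.
split.
  have [gamma_g gg_gt0 grad_steps] :=
    grad_stepsizes_exist A_sym H_LICQ H_G.
  have [gamma_h gh_gt0 escape_steps] := escape_stepsizes_exist H_H.
  exists gamma_g, gamma_h; split => // r P r_range PO.
  by split; [exact: grad_steps|exact: escape_steps].
move=> gamma_g gamma_h gg_gt0 gh_gt0 steps.
(* The potential at the start, when all of M is still to be spent. *)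
pose gap := fr D P0 - phistar + M.
have gap_gt0 : 0 < gap.
  have [r0_ge _] := andP r0_range.
  have := fr_ge_opt H_solvable (leq_trans rbar_ge r0_ge) P0_feas.
  by rewrite /gap; lra.
exists (gap * (gamma_g^-1 + gamma_h^-1) + 1), 1; split => //.
  by rewrite addr_gt0 // mulr_gt0 // addr_gt0 ?invr_gt0.
move=> eps eps_ge0 eps_sum eg eh eg_gt0 eh_gt0.
pose mu := decrement gamma_g gamma_h eg eh.
have mu_gt0 : 0 < mu by apply: decrement_gt0.
have gap_mu : 0 <= gap / mu by rewrite divr_ge0 // ltW.
have /andP[N_le N_gt] := truncn_itv gap_mu.
exists (Num.truncn (gap / mu)).+1; split.
  apply: (returns_within_budget A_sym rbar_ge tau_gt0 Rtr_retr Rtr2_retr H_LICQ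
            gg_gt0 gh_gt0 steps eg_gt0 eh_gt0 eps_ge0 H_solvable
            (partial_sum_le eps_ge0 eps_sum)) => //.
  by rewrite big_ord0 subr0 -ltr_pdivrMr.
move=> eg_le1 eh_le1.
have := @inv_decrement_le _ gamma_g gamma_h eg eh gg_gt0 gh_gt0.
rewrite eg_gt0 eh_gt0 eg_le1 eh_le1 => /(_ isT isT); rewrite -/mu => mu_le.
have eg2 : 1 <= eg ^- 2 by rewrite invf_ge1 ?exprn_gt0 // exprn_ile1 // ltW.
have eh3 : 0 <= eh ^- 3 by rewrite invr_ge0 exprn_ge0 // ltW.
have : gap / mu <= gap * (gamma_g^-1 * eg ^- 2 + gamma_h^-1 * eh ^- 3).
  by rewrite ler_pM2l.
(* The cross terms of the product in the announced bound. *)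
have : 0 <= gap * (gamma_g^-1 * eh ^- 3 + gamma_h^-1 * eg ^- 2).
  have eg2_ge0 := le_trans ler01 eg2.
  apply: mulr_ge0 (ltW gap_gt0) _.
  by rewrite addr_ge0 // mulr_ge0 // invr_ge0 ltW.
rewrite -natr1; lra.
Qed.
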